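(* The Nieuwland numbers $\nu$ of the following polyhedra satisfy the lower bounds: $\nu(\text{Tetrahedron})\ge 1.014473$; $\nu(\text{Dodecahedron})\ge 1.010818$; $\nu(\text{Icosahedron})\ge 1.010805$; $\nu(\text{Truncated tetrahedron})\ge 1.014210$; $\nu(\text{Truncated cube})\ge 1.030659$; $\nu(\text{Truncated octahedron})\ge 1.014602$; $\nu(\text{Rhombicuboctahedron})\ge 1.012819$; $\nu(\text{Truncated cuboctahedron})\ge 1.006563$; $\nu(\text{Icosidodecahedron})\ge 1.000878$; $\nu(\text{Truncated dodecahedron})\ge 1.001612$; $\nu(\text{Truncated icosahedron})\ge 1.001955$; $\nu(\text{Truncated icosidodecahedron})\ge 1.002048$.
   Context: A polyhedron $\mathbf{P}$ is a finite set of points of $\mathbb{R}^3$ (its vertices) in convex position and non-degenerate (not all contained in a plane). $T_{x,y}:\mathbb{R}^2\to\mathbb{R}^2$ is the translation by $(x,y)^t$; $R_\alpha:\mathbb{R}^2\to\mathbb{R}^2$ is the counter-clockwise rotation about the origin by the angle $\alpha$; and $M_{\theta,\varphi}:\mathbb{R}^3\to\mathbb{R}^2$ is the linear map with matrix $\begin{pmatrix}-\sin\theta&\cos\theta&0\\-\cos\theta\cos\varphi&-\sin\theta\cos\varphi&\sin\varphi\end{pmatrix}$. These maps act on sets elementwise. For a finite set $\mathcal{Q}\subset\mathbb{R}^2$, $\mathcal{Q}^\circ$ is the interior of its convex hull. The Nieuwland number $\nu(\mathbf{P})$ is the supremum over all $\mu\in\mathbb{R}$ for which there exist $x,y\in\mathbb{R}$,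 $\alpha,\theta_1,\theta_2\in[0,2\pi)$ and $\varphi_1,\varphi_2\in[0,\pi]$ with $(T_{x,y}\circ R_\alpha\circ M_{\theta_1,\varphi_1})(\mu\mathbf{P})\subset M_{\theta_2,\varphi_2}(\mathbf{P})^\circ$. Vertices of the solids, with $\Phi=(1+\sqrt5)/2$ and all sign choices allowed unless restricted: - Tetrahedron: $(\pm1,\pm1,\pm1)$ with an even number of minus signs. - Dodecahedron: $(\pm1,\pm1,\pm1)$ and all even permutations of $(0,\pm\Phi^{-1},\pm\Phi)$. - Icosahedron: even permutations of $(0,\pm\Phi,\pm1)$. - Truncated tetrahedron: all permutations of $(\pm1,\pm1,\pm3)$ with an even number of minus signs. - Truncated cube: all permutations of $(\pm1,\pm1,\pm(\sqrt2-1))$. - Truncated octahedron: all permutations of $(0,\pm1,\pm2)$. - Rhombicuboctahedron: all permutations of $(\pm1,\pm1,\pm(1+\sqrt2))$. - Truncated cuboctahedron: all permutations of $(\pm1,\pm(1+\sqrt2),\pm(1+2\sqrt2))$. - Icosidodecahedron: all permutations of $(0,0,\pm\Phi)$ and all even permutations of $(\pm\frac12,\pm\frac\Phi2,\pm\frac{\Phi^2}2)$. - Truncated dodecahedron: all even permutations of $(0,\pm\frac1\Phi,\pm(2+\Phi))$, $(\pm\frac1\Phi,\pm\Phi,\pm2\Phi)$ and $(\pm\Phi,\pm2,\pm(\Phi+1))$. - Truncated icosahedron: all odd permutations of $(0,\pm1,\pm3\Phi)$, $(\pm1,\pm(2+\Phi),\pm2\Phi)$ and $(\pm\Phi,\pm2,\pm(2\Phi+1))$.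 - Truncated icosidodecahedron: all even permutations of $(\pm\frac1\Phi,\pm\frac1\Phi,\pm(3+\Phi))$, $(\pm\frac2\Phi,\pm\Phi,\pm(1+2\Phi))$, $(\pm\frac1\Phi,\pm\Phi^2,\pm(-1+3\Phi))$, $(\pm(2\Phi-1),\pm2,\pm(2+\Phi))$ and $(\pm\Phi,\pm3,\pm2\Phi)$. *)

(* Defs.v *)
From mathcomp Require Import all_boot all_order all_fingroup all_algebra.
From mathcomp Require Import all_classical all_reals all_analysis.

Set Implicit Arguments.
Unset Strict Implicit.
Unset Printing Implicit Defensive.

Import Order.TTheory GRing.Theory Num.Theory.
Import numFieldNormedType.Exports.

Local Open Scope classical_set_scope.
Local Open Scope ring_scope.

Definition vec2 (R : realType) (a b : R) : 'cV[R]_2 :=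
  \col_(i < 2) [:: a; b]`_i.

Definition vec3 (R : realType) (a b c : R) : 'cV[R]_3 :=
  \col_(i < 3) [:: a; b; c]`_i.

Definition translation (R : realType) (x y : R) (v : 'cV[R]_2) : 'cV[R]_2 :=
  v + vec2 x y.

Definition rotation (R : realType) (alpha : R) (v : 'cV[R]_2) : 'cV[R]_2 :=
  (\matrix_(i < 2, j < 2)
     (nth [::] [:: [:: cos alpha; - sin alpha];
                   [:: sin alpha;   cos alpha]] i)`_j) *m v.

Definition projection (R : realType) (theta phi : R) (v : 'cV[R]_3) :
    'cV[R]_2 :=
  (\matrix_(i < 2, j < 3)
     (nth [::] [:: [:: - sin theta; cos theta; 0];
                   [:: - (cos theta * cos phi); - (sin theta * cos phi);
                       sin phi]] i)`_j) *m v.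

Definition convex_hull (R : realType) (M : lmodType R) (A : set M) : set M :=
  smallest (@convex_set R M) A.

Definition hull_interior (R : realType) (A : set 'cV[R]_2) : set 'cV[R]_2 :=
  (convex_hull A)°.

Definition nieuwland_feasible (R : realType) (P : set 'cV[R]_3) (mu : R) :
    Prop :=
  exists x y alpha theta1 theta2 phi1 phi2 : R,
    [/\ [/\ 0 <= alpha < 2 * pi, 0 <= theta1 < 2 * pi
          & 0 <= theta2 < 2 * pi],
        0 <= phi1 <= pi, 0 <= phi2 <= pi
      & (translation x y \o rotation alpha \o projection theta1 phi1)
          @` [set mu *: p | p in P]
        `<=` hull_interior (projection theta2 phi2 @` P)].

(* The supremum is taken in the extended reals, because the real-valued sup
   of the library is 0 on sets that are unbounded or empty.  A polyhedron is
   given by its set of vertices; the definition makes sense for any set. *)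
Definition nieuwland (R : realType) (P : set 'cV[R]_3) : \bar R :=
  ereal_sup (EFin @` [set mu | nieuwland_feasible P mu]).

(* All the vectors obtained from v by giving a minus sign to the coordinates
   whose index is in a set E of indices such that Q E, and then permuting the
   coordinates by a permutation s such that S s. *)
Definition signed_perms (R : realType) (S : pred 'S_3) (Q : pred {set 'I_3})
    (v : 'cV[R]_3) : set 'cV[R]_3 :=
  [set w | exists (s : 'S_3) (E : {set 'I_3}),
     [/\ S s, Q E & w = row_perm s (\col_i ((-1) ^+ (i \in E) * v i 0))]].

Definition any_perm : pred 'S_3 := xpredT.
Definition even_perm : pred 'S_3 := fun s => ~~ odd_perm s.

Definition any_signs : pred {set 'I_3} := xpredT.
Definition even_minus : pred {set 'I_3} := fun E => ~~ odd #|E|.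

Unset Implicit Arguments.

Definition golden (R : realType) : R := (1 + Num.sqrt 5) / 2.

Definition tetrahedron (R : realType) : set 'cV[R]_3 :=
  signed_perms (pred1 1%g) even_minus (vec3 1 1 1).

Definition dodecahedron (R : realType) : set 'cV[R]_3 :=
  let Phi := golden R in
  signed_perms (pred1 1%g) any_signs (vec3 1 1 1) `|`
  signed_perms even_perm any_signs (vec3 0 Phi^-1 Phi).

Definition icosahedron (R : realType) : set 'cV[R]_3 :=
  signed_perms even_perm any_signs (vec3 0 (golden R) 1).

Definition truncated_tetrahedron (R : realType) : set 'cV[R]_3 :=
  signed_perms any_perm even_minus (vec3 1 1 3).

Definition truncated_cube (R : realType) : set 'cV[R]_3 :=
  signed_perms any_perm any_signs (vec3 1 1 (Num.sqrt 2 - 1)).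

Definition truncated_octahedron (R : realType) : set 'cV[R]_3 :=
  signed_perms any_perm any_signs (vec3 0 1 2).

Definition rhombicuboctahedron (R : realType) : set 'cV[R]_3 :=
  signed_perms any_perm any_signs (vec3 1 1 (1 + Num.sqrt 2)).

Definition truncated_cuboctahedron (R : realType) : set 'cV[R]_3 :=
  signed_perms any_perm any_signs
    (vec3 1 (1 + Num.sqrt 2) (1 + 2 * Num.sqrt 2)).

Definition icosidodecahedron (R : realType) : set 'cV[R]_3 :=
  let Phi := golden R in
  signed_perms any_perm any_signs (vec3 0 0 Phi) `|`
  signed_perms even_perm any_signs (vec3 (1 / 2) (Phi / 2) (Phi ^+ 2 / 2)).

Definition truncated_dodecahedron (R : realType) : set 'cV[R]_3 :=
  let Phi := golden R in
  signed_perms even_perm any_signs (vec3 0 (1 / Phi) (2 + Phi)) `|`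
  signed_perms even_perm any_signs (vec3 (1 / Phi) Phi (2 * Phi)) `|`
  signed_perms even_perm any_signs (vec3 Phi 2 (Phi + 1)).

Definition truncated_icosahedron (R : realType) : set 'cV[R]_3 :=
  let Phi := golden R in
  signed_perms (@odd_perm 'I_3) any_signs (vec3 0 1 (3 * Phi)) `|`
  signed_perms (@odd_perm 'I_3) any_signs (vec3 1 (2 + Phi) (2 * Phi)) `|`
  signed_perms (@odd_perm 'I_3) any_signs (vec3 Phi 2 (2 * Phi + 1)).

Definition truncated_icosidodecahedron (R : realType) : set 'cV[R]_3 :=
  let Phi := golden R in
  signed_perms even_perm any_signs (vec3 (1 / Phi) (1 / Phi) (3 + Phi)) `|`
  signed_perms even_perm any_signs (vec3 (2 / Phi) Phi (1 + 2 * Phi)) `|`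
  signed_perms even_perm any_signs
    (vec3 (1 / Phi) (Phi ^+ 2) (-1 + 3 * Phi)) `|`
  signed_perms even_perm any_signs (vec3 (2 * Phi - 1) 2 (2 + Phi)) `|`
  signed_perms even_perm any_signs (vec3 Phi 3 (2 * Phi)).

(* Main.v *)
(* Every bound is witnessed by explicit data, found by numerical optimisation:
   angles whose half-angle tangents are rational, hence with rational sines and
   cosines, and a rational translation.  After clearing denominators all the
   coordinates lie in Z[sqrt d] with d = 2 or 5, where signs are decided by
   integer arithmetic.  A point is in the interior of the convex hull as soon as
   it lies strictly inside a triangle of points of the set, that is, as soon as
   three cross products are positive; for each solid a short list of triangles
   of outer vertices covers all the inner points. *)
From Stdlib Require Import BinInt.
Require Import Defs.
From mathcomp Require Import all_boot all_order all_fingroup all_algebra.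
From mathcomp Require Import all_classical all_reals all_analysis.
From mathcomp Require Import ring lra ssrZ.

Import Order.TTheory GRing.Theory Num.Theory.
Import numFieldNormedType.Exports.

Local Open Scope classical_set_scope.
Local Open Scope ring_scope.

(* [int_scope] has taken the key [Z]. *)
Delimit Scope Z_scope with ZZ.

(** * Angles and triangles *)

(** The angle is [acos c], whose sine is [|s|], reflected to [2 * pi - acos c] when [s < 0]. The
    clause giving [t <= pi] serves [phi1] and [phi2], which must lie in [0, pi]. *)
Lemma exists_angle {R : realType} (c s : R) : c ^+ 2 + s ^+ 2 = 1 ->
  exists t, [/\ 0 <= t < 2 * pi, 0 <= s -> t <= pi, cos t = c & sin t = s].
Proof.
move=> cs1.
have c1 : -1 <= c <= 1.
  by rewrite -ler_norml -(@expr_le1 _ 2) // real_normK ?num_real //; nra.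
have [t_ge0 t_lepi] := (acos_ge0 c1, acos_lepi c1).
have cos_t : cos (acos c) = c by rewrite acosK // in_itv.
have sin_t : sin (acos c) = `|s|.
  by rewrite sin_acos // (_ : 1 - c ^+ 2 = s ^+ 2) ?sqrtr_sqr //; lra.
have pi_gt0 := @pi_gt0 R.
have [s_ge0|s_lt0] := leP 0 s.
  exists (acos c); split=> //; first by apply/andP; split; lra.
  by rewrite sin_t ger0_norm.
(* If [acos c] were 0, the reflected angle would be [2 * pi], outside the half-open range; but its
   sine [|s|] is nonzero. *)
have t_gt0 : 0 < acos c.
  rewrite lt_neqAle t_ge0 andbT eq_sym; apply/eqP => t0.
  by move: sin_t; rewrite t0 sin0 ltr0_norm //; lra.
exists (2 * pi - acos c).
have t2pi : 2 * pi - acos c = - acos c + pi *+ 2 by rewrite mulr_natl addrC.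
split; first by apply/andP; split; lra.
- by move=> s_ge0; lra.
- by rewrite t2pi cosD2pi cosN.
- by rewrite t2pi sinD2pi sinN sin_t ltr0_norm // opprK.
Qed.

(** Twice the signed area of the triangle 0, [a], [b]. With [q] subtracted from both points,
    positivity says that [q] lies strictly to the left of the edge from [a] to [b]. *)
Definition cross {R : realType} (a b : 'cV[R]_2) : R :=
  a 0 0 * b 1 0 - a 1 0 * b 0 0.

(** The barycentric coordinates of [q] are proportional to the areas [u], [v], [w] of the
    subtriangles opposite [a], [b], [c]. The hull is the smallest convex set, so [q] has to lie in
    every convex [B] containing [A]. *)
Lemma convex_hull_triangle {R : realType} (A : set 'cV[R]_2)
    (a b c q : 'cV[R]_2) : A a -> A b -> A c ->
  0 < cross (a - q) (b - q) -> 0 < cross (b - q) (c - q) ->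
  0 < cross (c - q) (a - q) -> convex_hull A q.
Proof.
move=> Aa Ab Ac.
set w := cross _ _; set u := cross _ _; set v := cross _ _ => w0 u0 v0.
move=> B [convB AB].
have conv (x y : 'cV[R]_2) (t : R) : B x -> B y -> 0 <= t <= 1 ->
    B (t *: x + (1 - t) *: y).
  move=> Bx By /andP[t0 t1]; have := convB x y (Itv01 t0 t1).
  by rewrite !inE; apply.
(* Convexity combines two points at a time, so the three-point barycentre is nested: first [b] with
   [c], then the result with [a]. *)
have Bq : B ((u / (u + v + w)) *: a + (1 - u / (u + v + w)) *:
    ((v / (v + w)) *: b + (1 - v / (v + w)) *: c)).
  refine (conv _ _ _ _ _ _);
    [exact: AB | refine (conv _ _ _ _ _ _); [exact: AB | exact: AB |] |];
    by rewrite divr_ge0 ?ler_pdivrMr /=; lra.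
rewrite (_ : q = (u / (u + v + w)) *: a + (1 - u / (u + v + w)) *:
    ((v / (v + w)) *: b + (1 - v / (v + w)) *: c)) //.
have e1 : u + v + w != 0 by lra.
have e2 : v + w != 0 by lra.
apply/matrixP => i j; rewrite (ord1 j) !mxE.
move: e1 e2; rewrite /u /v /w /cross !mxE.
case: i => [[|[|//]]] lti /=.
  rewrite (_ : Ordinal lti = 0); last exact: val_inj.
  by move=> *; field; apply/andP.
rewrite (_ : Ordinal lti = 1); last exact: val_inj.
by move=> *; field; apply/andP.
Qed.

(** The three cross products are continuous in [q], so they stay positive on a neighbourhood of [q],
    which therefore lies in the hull. *)
Lemma hull_interior_triangle {R : realType} (A : set 'cV[R]_2)
    (a b c q : 'cV[R]_2) : A a -> A b -> A c ->
  0 < cross (a - q) (b - q) -> 0 < cross (b - q) (c - q) ->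
  0 < cross (c - q) (a - q) -> hull_interior A q.
Proof.
move=> Aa Ab Ac ab0 bc0 ca0.
have cross_near (p r : 'cV[R]_2) : 0 < cross (p - q) (r - q) ->
    \forall x \near q, 0 < cross (p - x) (r - x).
  move=> pr0; suff cnt : {for q,
      continuous (fun x : 'cV[R]_2 => cross (p - x) (r - x))}.
    by apply: (cvgr_gt _ cnt).
  have coord (s : 'cV[R]_2) i :
      {for q, continuous (fun x : 'cV[R]_2 => (s - x) i 0)}.
    rewrite (_ : (fun x : 'cV_2 => _) = (fun x => s i 0 - x i 0)); last first.
      by apply/funext => x; rewrite !mxE.
    by apply: continuousB; [exact: cst_continuous | exact: coord_continuous].
  by rewrite /cross; apply: continuousB; apply: continuousM; exact: coord.
rewrite /hull_interior /interior.
near=> x.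
apply: (@convex_hull_triangle R A a b c) => //; near: x; exact: cross_near.
Unshelve. all: by end_near.
Qed.

(** * Coordinate formulas for the projection, the rotation and the translation *)

Lemma projectionE {R : realType} (theta phi : R) (v : 'cV[R]_3) :
  projection theta phi v = vec2
    (- sin theta * v 0 0 + cos theta * v 1 0)
    (- (cos theta * cos phi) * v 0 0 - sin theta * cos phi * v 1 0
     + sin phi * v 2 0).
Proof.
apply/matrixP => i j; rewrite (ord1 j) !mxE !big_ord_recl big_ord0 !mxE /=.
have -> : lift ord0 (ord0 : 'I_2) = 1 :> 'I_3 by exact: val_inj.
have -> : lift ord0 (lift ord0 (ord0 : 'I_1)) = 2 :> 'I_3 by exact: val_inj.
by case: i => [[|[|//]]] /= _; ring.
Qed.

Lemma rotationE {R : realType} (alpha x y : R) :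
  rotation alpha (vec2 x y) =
  vec2 (cos alpha * x - sin alpha * y) (sin alpha * x + cos alpha * y).
Proof.
apply/matrixP => i j; rewrite (ord1 j) !mxE !big_ord_recl big_ord0 !mxE /=.
by case: i => [[|[|//]]] /= _; ring.
Qed.

Lemma translationE {R : realType} (x y a b : R) :
  translation x y (vec2 a b) = vec2 (a + x) (b + y).
Proof. by apply/matrixP => i j; rewrite !mxE; case: i => [[|[|//]]]. Qed.

(** * Arithmetic in Z[sqrt d] *)

(** Certificates live in the binary integers [Z], on which computation is fast; this ring morphism
    carries them to the reals. *)
Definition zr (R : realType) (z : Z) : R := (int_of_Z z)%:~R.

Section ZReal.
Context {R : realType}.
Local Notation zr := (zr R).

Lemma zr0 : zr 0%ZZ = 0. Proof. by []. Qed.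

Lemma zrD x y : zr (x + y)%ZZ = zr x + zr y.
Proof. by rewrite /zr -intrD -rmorphD. Qed.

Lemma zrN x : zr (- x)%ZZ = - zr x.
Proof. by rewrite /zr -intrN -rmorphN. Qed.

Lemma zrB x y : zr (x - y)%ZZ = zr x - zr y.
Proof. by rewrite -Z.add_opp_r zrD zrN. Qed.

Lemma zrM x y : zr (x * y)%ZZ = zr x * zr y.
Proof. by rewrite /zr -intrM -rmorphM. Qed.

Lemma zr_nat n : zr (Z.of_nat n) = n%:R.
Proof. by rewrite /zr -[Z.of_nat n]/(Z_of_int n) Z_of_intK. Qed.

Lemma zr_ge0 x : (0 <=? x)%ZZ -> 0 <= zr x.
Proof. by case: x => // p _; rewrite /zr ler0z. Qed.

Lemma zr_gt0 x : (0 <? x)%ZZ -> 0 < zr x.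
Proof.
case: x => // p _; rewrite /zr ltr0z /= ltz_nat.
exact/ssrnat.ltP/Pos2Nat.is_pos.
Qed.

End ZReal.

(* The pair (a, b) stands for a + b sqrt d. *)
Definition quad : Type := (Z * Z)%type.

Definition qint (a : Z) : quad := (a, 0%ZZ).
Definition qadd (k l : quad) : quad := ((k.1 + l.1)%ZZ, (k.2 + l.2)%ZZ).
Definition qopp (k : quad) : quad := ((- k.1)%ZZ, (- k.2)%ZZ).
Definition qsub (k l : quad) : quad := ((k.1 - l.1)%ZZ, (k.2 - l.2)%ZZ).
Definition qscale (z : Z) (k : quad) : quad := ((z * k.1)%ZZ, (z * k.2)%ZZ).
Definition qmul (d : Z) (k l : quad) : quad :=
  ((k.1 * l.1 + d * (k.2 * l.2))%ZZ, (k.1 * l.2 + k.2 * l.1)%ZZ).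

(* Only sufficient for positivity: it fails when a = 0 < b. *)
Definition qpos (d : Z) (k : quad) : bool :=
  let: (a, b) := k in
  if (0 <=? a)%ZZ then
    if (0 <=? b)%ZZ then (0 <? a)%ZZ else (0 <? a * a - d * (b * b))%ZZ
  else (0 <=? b)%ZZ && (0 <? d * (b * b) - a * a)%ZZ.

Section QuadReal.
Context {R : realType} {d : Z}.
Hypothesis d_ge0 : (0 <=? d)%ZZ.

Definition qr (k : quad) : R := zr R k.1 + zr R k.2 * Num.sqrt (zr R d).

Lemma sqr_sqrt_d : Num.sqrt (zr R d) ^+ 2 = zr R d.
Proof. by rewrite sqr_sqrtr // zr_ge0. Qed.

Lemma qr_int a : qr (qint a) = zr R a.
Proof. by rewrite /qr mul0r addr0. Qed.

Lemma qrD k l : qr (qadd k l) = qr k + qr l.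
Proof. by rewrite /qr !zrD; ring. Qed.

Lemma qrN k : qr (qopp k) = - qr k.
Proof. by rewrite /qr !zrN; ring. Qed.

Lemma qrB k l : qr (qsub k l) = qr k - qr l.
Proof. by rewrite /qr !zrB; ring. Qed.

Lemma qrZ z k : qr (qscale z k) = zr R z * qr k.
Proof. by rewrite /qr !zrM; ring. Qed.

Lemma qrM k l : qr (qmul d k l) = qr k * qr l.
Proof.
by rewrite /qr !zrD !zrM; have := sqr_sqrt_d; set w := Num.sqrt _ => <-; ring.
Qed.

(** When a and b have opposite signs, the sign of a + b sqrt d is that of the term with the larger
    square, found by comparing a^2 with d b^2. *)
Lemma qpos_gt0 k : qpos d k -> 0 < qr k.
Proof.
case: k => a b; rewrite /qr /=.
have := sqr_sqrt_d; have : 0 <= Num.sqrt (zr R d) by exact: sqrtr_ge0.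
set w := Num.sqrt _ => w_ge0 w2.
case: ifP => [a_ge0|/negbT a_lt0].
  have {}a_ge0 := zr_ge0 (R := R) _ a_ge0.
  case: ifP => [b_ge0 a_gt0|/negbT b_lt0].
    have {}b_ge0 := zr_ge0 (R := R) _ b_ge0.
    by apply: ltr_wpDr; [exact: mulr_ge0 | exact: zr_gt0].
  move=> /(zr_gt0 (R := R)); rewrite zrB !zrM -w2 => ab.
  have : (zr R b * w) ^+ 2 < zr R a ^+ 2 by rewrite exprMn; lra.
  by rewrite -[_ ^+ 2 < _]ltr_sqrt ?exprn_gt0 // ?sqrtr_sqr; nra.
move=> /andP[b_ge0 /(zr_gt0 (R := R))]; rewrite zrB !zrM -w2.
have {}b_ge0 := zr_ge0 (R := R) _ b_ge0.
have bw_ge0 : 0 <= zr R b * w by exact: mulr_ge0.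
move: bw_ge0; set t := _ * w => t_ge0 H; have : zr R a * zr R a < t * t.
  by rewrite /t; lra.
by nra.
Qed.

End QuadReal.
Arguments qr R d k : clear implicits.

(** * Enumeration of signed permutations *)

Lemma ord3P (i : 'I_3) : [\/ i = 0, i = 1 | i = 2].
Proof.
case: i => [[|[|[|//]]]] lti; 
  [apply: Or31 | apply: Or32 | apply: Or33]; exact: val_inj.
Qed.

Lemma eq_perm3 (s t : 'S_3) : s 0 = t 0 -> s 1 = t 1 -> s = t.
Proof.
move=> e0 e1; apply/permP => i; case: (ord3P i) => [->|->|->] //.
have : s 1 != s 0 by rewrite (inj_eq perm_inj).
have : s 2 != s 0 by rewrite (inj_eq perm_inj).
have : s 2 != s 1 by rewrite (inj_eq perm_inj).
have : t 2 != t 0 by rewrite (inj_eq perm_inj).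
have : t 2 != t 1 by rewrite (inj_eq perm_inj).
rewrite -e0 -e1.
by case: (ord3P (s 0)) => ->; case: (ord3P (s 1)) => ->;
  case: (ord3P (s 2)) => ->; case: (ord3P (t 2)) => ->; rewrite ?eqxx.
Qed.

(** Permutations, and below sign sets, are coded by the tuples of their values, so that vertex lists
    can be evaluated by computation. *)
Definition perm_code (s : 'S_3) : nat * nat * nat :=
  (nat_of_ord (s 0), nat_of_ord (s 1), nat_of_ord (s 2)).

Lemma perm_code_inj : injective perm_code.
Proof. by move=> s t [e0 e1 _]; apply: eq_perm3; exact: val_inj. Qed.

Definition id_codes := [:: (0, 1, 2)]%N.
(** The even permutations of three letters are the cyclic shifts; the odd ones are the three
    transpositions. *)
Definition even_codes := [:: (0, 1, 2); (1, 2, 0); (2, 0, 1)]%N.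
Definition odd_codes := [:: (0, 2, 1); (2, 1, 0); (1, 0, 2)]%N.
Definition any_codes := even_codes ++ odd_codes.

Definition enumerates_perms (ps : seq (nat * nat * nat)) (S : pred 'S_3) :=
  perm_code @` [set s | S s] = [set` ps].

Lemma perm_code_any s : perm_code s \in any_codes.
Proof.
have : s 0 != s 1 by rewrite (inj_eq perm_inj).
have : s 0 != s 2 by rewrite (inj_eq perm_inj).
have : s 1 != s 2 by rewrite (inj_eq perm_inj).
rewrite /perm_code.
by case: (ord3P (s 0)) => ->; case: (ord3P (s 1)) => ->;
  case: (ord3P (s 2)) => ->; rewrite ?eqxx.
Qed.

(** Each code is realised by an explicit product of at most two transpositions, whose number gives
    the parity. *)
Lemma perm_code_exists c : c \in any_codes ->
  exists2 s : 'S_3, perm_code s = c & odd_perm s = (c \in odd_codes).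
Proof.
pose t01 : 'S_3 := tperm 0 1; pose t02 : 'S_3 := tperm 0 2.
have code1 : perm_code 1%g = (0, 1, 2)%N by rewrite /perm_code !perm1.
have code01 : perm_code (tperm 0 1) = (1, 0, 2)%N.
  by rewrite /perm_code tpermL tpermR tpermD.
have code02 : perm_code (tperm 0 2) = (2, 1, 0)%N.
  by rewrite /perm_code tpermL tpermR tpermD.
have code12 : perm_code (tperm 1 2) = (0, 2, 1)%N.
  by rewrite /perm_code tpermL tpermR tpermD.
have code120 : perm_code (t01 * t02)%g = (1, 2, 0)%N.
  by rewrite /perm_code /t01 /t02 !permM !permE.
have code201 : perm_code (t02 * t01)%g = (2, 0, 1)%N.
  by rewrite /perm_code /t01 /t02 !permM !permE.
rewrite /any_codes /even_codes /odd_codes mem_cat !inE -!orbA.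
move=> /or4P[/eqP->|/eqP->|/eqP->|/or3P[]/eqP->].
- by exists 1%g; rewrite ?odd_perm1.
- by exists (t01 * t02)%g; rewrite ?odd_permM ?odd_tperm.
- by exists (t02 * t01)%g; rewrite ?odd_permM ?odd_tperm.
- by exists (tperm 1 2); rewrite ?odd_tperm.
- by exists (tperm 0 2); rewrite ?odd_tperm.
- by exists (tperm 0 1); rewrite ?odd_tperm.
Qed.

(** By injectivity of the coding, the permutation realising the code of [s] is [s] itself, so its
    known parity applies. *)
Lemma odd_permE s : odd_perm s = (perm_code s \in odd_codes).
Proof.
by have [t /perm_code_inj->] := perm_code_exists _ (perm_code_any s).
Qed.

Lemma enumerates_perms_pred ps S : {subset ps <= any_codes} ->
  (forall s, S s = (perm_code s \in ps)) -> enumerates_perms ps S.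
Proof.
move=> ps_any SE; apply/seteqP; split=> [_ [s Ss <-]|c /= c_ps] /=.
  by rewrite -SE.
have [s sc _] := perm_code_exists _ (ps_any _ c_ps).
by exists s => //=; rewrite SE sc.
Qed.

Lemma enumerates_id : enumerates_perms id_codes (pred1 1%g).
Proof.
apply: enumerates_perms_pred => [c|s]; first by rewrite !inE => ->.
rewrite /= inE -(inj_eq perm_code_inj); congr (_ == _).
by rewrite /perm_code !perm1.
Qed.

Lemma enumerates_even : enumerates_perms even_codes even_perm.
Proof.
apply: enumerates_perms_pred => [c|s]; first by rewrite mem_cat => ->.
rewrite /even_perm odd_permE; move: (perm_code_any s).
rewrite /any_codes /even_codes /odd_codes mem_cat !inE -!orbA.
by move=> /or4P[/eqP->|/eqP->|/eqP->|/or3P[]/eqP->].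
Qed.

Lemma enumerates_odd : enumerates_perms odd_codes (@odd_perm 'I_3).
Proof.
apply: enumerates_perms_pred => [c|s]; first by rewrite mem_cat orbC => ->.
exact: odd_permE.
Qed.

Lemma enumerates_any : enumerates_perms any_codes any_perm.
Proof. by apply: enumerates_perms_pred => // s; rewrite perm_code_any. Qed.

Definition signs_code (E : {set 'I_3}) : bool * bool * bool :=
  (0 \in E, 1 \in E, 2 \in E).

Definition any_sign_codes : seq (bool * bool * bool) :=
  let bools := [:: false; true] in
  [seq (xy, z) | xy <- [seq (x, y) | x <- bools, y <- bools], z <- bools].
Definition even_sign_codes :=
  [seq e <- any_sign_codes | ~~ (e.1.1 (+) e.1.2 (+) e.2)].

Definition enumerates_signs (es : seq (bool * bool * bool))
    (Q : pred {set 'I_3}) := signs_code @` [set E | Q E] = [set` es].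

Lemma signs_code_exists e : exists E, signs_code E = e.
Proof.
case: e => [[x y] z].
exists [set i : 'I_3 | nth false [:: x; y; z] i]%SET.
by rewrite /signs_code !inE.
Qed.

Lemma odd_card_signs (E : {set 'I_3}) :
  odd #|E| = (0 \in E) (+) (1 \in E) (+) (2 \in E).
Proof.
rewrite -sum1_card big_mkcond !big_ord_recl big_ord0 /= addn0 !oddD.
have -> : lift ord0 (ord0 : 'I_2) = 1 :> 'I_3 by exact: val_inj.
have -> : lift ord0 (lift ord0 (ord0 : 'I_1)) = 2 :> 'I_3 by exact: val_inj.
by rewrite addbA; do 3 case: ifP => _.
Qed.

Lemma enumerates_any_signs : enumerates_signs any_sign_codes any_signs.
Proof.
apply/seteqP; split=> [_ [E _ <-]|e _] /=.
  by rewrite /signs_code; do 3 case: (_ \in E).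
by have [E] := signs_code_exists e; exists E.
Qed.

Lemma enumerates_even_signs : enumerates_signs even_sign_codes even_minus.
Proof.
apply/seteqP; split=> [_ [E /= ev <-]|e /=]; rewrite mem_filter.
  move: ev; rewrite /even_minus odd_card_signs /= => ->.
  by rewrite /signs_code; do 3 case: (_ \in E).
move=> /andP[ev _]; have [E Ee] := signs_code_exists e.
by exists E => //=; rewrite /even_minus odd_card_signs; move: ev; rewrite -Ee.
Qed.

Definition quad3 : Type := (quad * quad * quad)%type.

Definition qvec {R : realType} (d : Z) (k : quad3) : 'cV[R]_3 :=
  vec3 (qr R d k.1.1) (qr R d k.1.2) (qr R d k.2).

(** Mirrors [row_perm]: coordinate i of the result is coordinate s(i) of the signed vector, and [p]
    lists the values s(i). *)
Definition sign_perm (v : quad3) (p : nat * nat * nat)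
    (e : bool * bool * bool) : quad3 :=
  let sg (b : bool) k := if b then qopp k else k in
  let w := [:: sg e.1.1 v.1.1; sg e.1.2 v.1.2; sg e.2 v.2] in
  let nw i := nth (qint 0) w i in
  (nw p.1.1, nw p.1.2, nw p.2).

(** Vertices are repeated when coordinates of [v] vanish or coincide; the triangles below refer to
    positions in the lists with these repetitions. *)
Definition signed_codes ps es (v : quad3) : seq quad3 :=
  [seq sign_perm v p e | p <- ps, e <- es].

(** Scaling by [lambda], which clears denominators, commutes with sign changes and permutations, so
    the scaled orbit of [u] is the coded orbit of [v]. *)
Lemma signed_permsE (R : realType) (d : Z) S Q ps es (v : quad3) (lambda : R)
    (u : 'cV[R]_3) :
  enumerates_perms ps S -> enumerates_signs es Q ->
  lambda *: u = qvec d v ->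
  [set lambda *: p | p in signed_perms S Q u] =
  [set qvec d k | k in [set` signed_codes ps es v]].
Proof.
move=> psE esE uv.
have key (s : 'S_3) (E : {set 'I_3}) :
    lambda *: row_perm s (\col_i ((-1) ^+ (i \in E) * u i 0)) =
    qvec d (sign_perm v (perm_code s) (signs_code E)).
  have uE i :
      lambda * u i 0 = nth 0 [:: qr R d v.1.1; qr R d v.1.2; qr R d v.2] i.
    by have /matrixP/(_ i 0) := uv; rewrite !mxE.
  have nthE (i : 'I_3) : qr R d (nth (qint 0)
      [:: if 0 \in E then qopp v.1.1 else v.1.1;
          if 1 \in E then qopp v.1.2 else v.1.2;
          if 2 \in E then qopp v.2 else v.2] i) =
      lambda * ((-1) ^+ (i \in E) * u i 0).
    rewrite mulrCA uE.
    by case: (ord3P i) => -> /=; case: ifP => _; rewrite ?qrN ?mulN1r ?mul1r.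
  apply/matrixP => i j; rewrite (ord1 j) !mxE /=.
  by case: (ord3P i) => -> /=; rewrite nthE.
apply/seteqP; split=> [_ [_ [s [E [Ss QE ->]]] <-]|_ [k /= k_in <-]] /=.
  exists (sign_perm v (perm_code s) (signs_code E)); last by rewrite key.
  apply/allpairsP; exists (perm_code s, signs_code E); split=> //=.
    have : (perm_code @` [set s | S s]) (perm_code s) by exists s.
    by rewrite psE.
  have : (signs_code @` [set E | Q E]) (signs_code E) by exists E.
  by rewrite esE.
have /allpairsP[[p e] [/= p_in e_in ->]] := k_in.
have : [set` ps] p by []. rewrite -psE => -[s Ss <-].
have : [set` es] e by []. rewrite -esE => -[E QE <-].
exists (row_perm s (\col_i ((-1) ^+ (i \in E) * u i 0))); last exact: key.
by exists s, E.
Qed.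

(** * Rational placements *)

(* The pair (m, n) encodes the angle t with tan (t / 2) = m / n, whose cosine
   and sine are (n^2 - m^2) / (n^2 + m^2) and 2 m n / (n^2 + m^2); n = 0
   stands for t = pi. *)
Definition half_tangent : Type := (Z * Z)%type.

Definition hcos (t : half_tangent) : Z := (t.2 * t.2 - t.1 * t.1)%ZZ.
Definition hsin (t : half_tangent) : Z := (2 * t.1 * t.2)%ZZ.
Definition hnorm (t : half_tangent) : Z := (t.2 * t.2 + t.1 * t.1)%ZZ.

(** Stated without division, so that every later identity remains polynomial in the integer data. *)
Definition is_angle {R : realType} (t : half_tangent) (a : R) :=
  zr R (hnorm t) * cos a = zr R (hcos t) /\
  zr R (hnorm t) * sin a = zr R (hsin t).

(** The identity (n^2 - m^2)^2 + (2 m n)^2 = (n^2 + m^2)^2 puts the two quotients on the unit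
    circle. *)
Lemma exists_half_tangent_angle (R : realType) (t : half_tangent) :
  (0 <? hnorm t)%ZZ ->
  exists a : R, [/\ 0 <= a < 2 * pi, (0 <=? hsin t)%ZZ -> a <= pi
                  & is_angle t a].
Proof.
move=> t_gt0.
have e_gt0 : 0 < zr R (hnorm t) by exact: zr_gt0.
have [|a [a_bnd a_pi cos_a sin_a]] := @exists_angle R
    (zr R (hcos t) / zr R (hnorm t)) (zr R (hsin t) / zr R (hnorm t)).
  move: e_gt0; rewrite /hcos /hsin /hnorm zrB zrD !zrM.
  by rewrite -[zr R 2]/(2 : R) => e_gt0; field; exact: lt0r_neq0.
exists a; split=> //.
  by move=> s_ge0; apply: a_pi; apply: divr_ge0; [exact: zr_ge0 | exact: ltW].
by split; rewrite ?cos_a ?sin_a mulrC divfK // lt0r_neq0.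
Qed.

(** * Projection, rotation and cross product over Z[sqrt d], up to scale *)

Definition quad2 : Type := (quad * quad)%type.

Definition qvec2 {R : realType} (d : Z) (k : quad2) : 'cV[R]_2 :=
  vec2 (qr R d k.1) (qr R d k.2).

Definition q2scale (z : Z) (k : quad2) : quad2 := (qscale z k.1, qscale z k.2).

Definition zdot (r : Z * Z * Z) (k : quad3) : quad :=
  qadd (qadd (qscale r.1.1 k.1.1) (qscale r.1.2 k.1.2)) (qscale r.2 k.2).

(** The whole matrix is multiplied by [hnorm th * hnorm ph]; entries involving only one of the two
    angles retain the norm of the other. *)
Definition zproj (th ph : half_tangent) (k : quad3) : quad2 :=
  (zdot ((- (hsin th * hnorm ph))%ZZ, (hcos th * hnorm ph)%ZZ, 0%ZZ) k,
   zdot ((- (hcos th * hcos ph))%ZZ, (- (hsin th * hcos ph))%ZZ,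
         (hsin ph * hnorm th)%ZZ) k).

Definition zrot (al : half_tangent) (k : quad2) : quad2 :=
  (qsub (qscale (hcos al) k.1) (qscale (hsin al) k.2),
   qadd (qscale (hsin al) k.1) (qscale (hcos al) k.2)).

Definition zcross (d : Z) (a b q : quad2) : quad :=
  qsub (qmul d (qsub a.1 q.1) (qsub b.2 q.2))
       (qmul d (qsub a.2 q.2) (qsub b.1 q.1)).

Section ScaledImages.
Context {R : realType} {d : Z}.

Lemma scale_vec2 (c a b : R) : c *: vec2 a b = vec2 (c * a) (c * b).
Proof. by apply/matrixP => i j; rewrite !mxE; case: i => [[|[|//]]]. Qed.

Lemma vec2_inj (a b a' b' : R) : vec2 a b = vec2 a' b' -> a = a' /\ b = b'.
Proof. by move=> /matrixP e; have := e 0 0; have := e 1 0; rewrite !mxE. Qed.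

Lemma qvec2Z z k : qvec2 d (q2scale z k) = zr R z *: qvec2 d k.
Proof. by rewrite /qvec2 scale_vec2 !qrZ. Qed.

Lemma zprojP th ph (theta phi lambda : R) (p : 'cV[R]_3) k :
  is_angle th theta -> is_angle ph phi -> lambda *: p = qvec d k ->
  (zr R (hnorm th) * zr R (hnorm ph) * lambda) *: projection theta phi p =
  qvec2 d (zproj th ph k).
Proof.
move=> [cth sth] [cph sph] pk.
have e0 : lambda * p 0 0 = qr R d k.1.1.
  by have /matrixP/(_ 0 0) := pk; rewrite !mxE.
have e1 : lambda * p 1 0 = qr R d k.1.2.
  by have /matrixP/(_ 1 0) := pk; rewrite !mxE.
have e2 : lambda * p 2 0 = qr R d k.2.
  by have /matrixP/(_ 2 0) := pk; rewrite !mxE.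
rewrite projectionE scale_vec2 /qvec2 /zproj /zdot /=.
move: (hcos th) (hsin th) (hnorm th) (hcos ph) (hsin ph) (hnorm ph)
  cth sth cph sph => C S N C' S' N' cth sth cph sph.
rewrite !qrD !qrZ !zrN !zrM.
by rewrite -e0 -e1 -e2 -cth -sth -cph -sph zr0; congr vec2; ring.
Qed.

Lemma zrotP al (alpha lambda : R) v k :
  is_angle al alpha -> lambda *: v = qvec2 d k ->
  (zr R (hnorm al) * lambda) *: rotation alpha v = qvec2 d (zrot al k).
Proof.
move=> [cal sal].
have -> : v = vec2 (v 0 0) (v 1 0).
  by apply/matrixP => i j; rewrite (ord1 j) !mxE; case: i => [[|[|//]]] lti;
    congr (v _ _); exact: val_inj.
rewrite scale_vec2 => /vec2_inj[e0 e1].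
rewrite rotationE scale_vec2 /qvec2 /zrot /= qrB qrD !qrZ.
by rewrite -e0 -e1 -cal -sal; congr vec2; ring.
Qed.

(** Scaling all three points by [lambda] multiplies the cross product by [lambda ^+ 2], which
    preserves its sign. *)
Lemma zcross_gt0 (lambda : R) a b q a' b' q' : (0 <=? d)%ZZ -> 0 < lambda ->
  lambda *: a = qvec2 d a' -> lambda *: b = qvec2 d b' ->
  lambda *: q = qvec2 d q' -> qpos d (zcross d a' b' q') ->
  0 < cross (a - q) (b - q).
Proof.
move=> d_ge0 l_gt0 ea eb eq /(qpos_gt0 (R := R) d_ge0).
have coord v k : lambda *: v = qvec2 d k ->
    qr R d k.1 = lambda * v 0 0 /\ qr R d k.2 = lambda * v 1 0.
  by move=> /matrixP e; have := e 0 0; have := e 1 0; rewrite !mxE /= => -> ->.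
have [a0 a1] := coord _ _ ea; have [b0 b1] := coord _ _ eb.
have [q0 q1] := coord _ _ eq.
rewrite /zcross qrB !(qrM d_ge0) !qrB a0 a1 b0 b1 q0 q1 /cross !mxE => H.
by rewrite -(pmulr_rgt0 _ (exprn_gt0 2 l_gt0)); lra.
Qed.

End ScaledImages.

(** * Integer certificates for a passage and the soundness of their check *)

Record placement := Placement {
  theta1 : half_tangent; phi1 : half_tangent; alpha : half_tangent;
  theta2 : half_tangent; phi2 : half_tangent; shift : Z * Z }.

Definition million : Z := 1000000%ZZ.

Definition inner_norm (w : placement) : Z :=
  (hnorm (alpha w) * (hnorm (theta1 w) * hnorm (phi1 w)))%ZZ.
Definition outer_norm (w : placement) : Z :=
  (hnorm (theta2 w) * hnorm (phi2 w))%ZZ.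

(* Both images are multiplied by million * inner_norm w * outer_norm w and by
   the scale L of the vertex list; the factor mu and the translation are given
   in millionths. *)
Definition inner_image (w : placement) (L mu : Z) (k : quad3) : quad2 :=
  let v := q2scale mu (zrot (alpha w) (zproj (theta1 w) (phi1 w) k)) in
  let c := (L * inner_norm w)%ZZ in
  q2scale (outer_norm w)
    (qadd v.1 (qint (c * (shift w).1)%ZZ),
     qadd v.2 (qint (c * (shift w).2)%ZZ)).

Definition outer_image (w : placement) (k : quad3) : quad2 :=
  q2scale (million * inner_norm w)%ZZ (zproj (theta2 w) (phi2 w) k).

Definition in_triangle (d : Z) (t : quad2 * quad2 * quad2) (q : quad2) : bool :=
  [&& qpos d (zcross d t.1.1 t.1.2 q), qpos d (zcross d t.1.2 t.2 q)
    & qpos d (zcross d t.2 t.1.1 q)].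

(** Positive norms exclude the pair (0, 0), which encodes no angle; nonnegative sines put [phi1] and
    [phi2] in [0, pi]. *)
Definition valid_placement (w : placement) : bool :=
  [&& all (fun t => (0 <? hnorm t)%ZZ)
        [:: theta1 w; phi1 w; alpha w; theta2 w; phi2 w],
      (0 <=? hsin (phi1 w))%ZZ & (0 <=? hsin (phi2 w))%ZZ].

(** Triangles are triples of positions in [vs], listed counter-clockwise as seen in the outer image.
    The size tests ensure that the default [z] is never taken for a vertex. *)
Definition check_passage (d L mu : Z) (vs : seq quad3) (w : placement)
    (ts : seq (nat * nat * nat)) : bool :=
  let im := [seq outer_image w k | k <- vs] in
  let z := (qint 0%ZZ, qint 0%ZZ) in
  let ts' := [seq (nth z im t.1.1, nth z im t.1.2, nth z im t.2) | t <- ts] in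
  [&& (0 <=? d)%ZZ, (0 <? L)%ZZ, valid_placement w,
      all (fun t => [&& t.1.1 < size vs, t.1.2 < size vs & t.2 < size vs]%N) ts
    & all (fun k => has (in_triangle d ^~ (inner_image w L mu k)) ts') vs].

(** Multiplied by one common positive factor [lambda], the real inner and outer images become the
    computed ones, so the verified signs are those of the real cross products. *)
Lemma check_passageP (R : realType) (P : set 'cV[R]_3) d L mu vs w ts :
  [set zr R L *: p | p in P] = [set qvec d k | k in [set` vs]] ->
  check_passage d L mu vs w ts ->
  nieuwland_feasible P (zr R mu / 10 ^+ 6).
Proof.
move=> PE /and5P[d_ge0 L_gt0 /and3P[]].
case: w => th1 ph1 al th2 ph2 [X Y] /=.
set w := Placement _ _ _ _ _ _.
move=> /and5P[th1_gt0 ph1_gt0 al_gt0 th2_gt0] /andP[ph2_gt0 _] ph1_pi ph2_pi.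
move=> ts_lt covered.
have [t1 [t1_bnd _ t1P]] := exists_half_tangent_angle R _ th1_gt0.
have [p1 [/andP[p1_ge0 _] /(_ ph1_pi) p1_le p1P]] :=
  exists_half_tangent_angle R _ ph1_gt0.
have [a [a_bnd _ aP]] := exists_half_tangent_angle R _ al_gt0.
have [t2 [t2_bnd _ t2P]] := exists_half_tangent_angle R _ th2_gt0.
have [p2 [/andP[p2_ge0 _] /(_ ph2_pi) p2_le p2P]] :=
  exists_half_tangent_angle R _ ph2_gt0.
have millE : zr R million = 10 ^+ 6.
  (* Factoring into tens avoids unfolding a million as a unary numeral. *)
  have -> : million = (10 * 10 * 10 * 10 * 10 * 10)%ZZ by [].
  by rewrite !zrM -[zr R 10]/(10%:R : R); ring.
have mill_gt0 : 0 < 10 ^+ 6 :> R by rewrite exprn_gt0.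
have mill_neq0 := lt0r_neq0 mill_gt0.
exists (zr R X / 10 ^+ 6), (zr R Y / 10 ^+ 6), a, t1, t2, p1, p2.
split; [by split | by rewrite p1_ge0 | by rewrite p2_ge0 |].
move=> _ [_ [p Pp <-] <-] /=.
have [k k_vs pk] : exists2 k, k \in vs & zr R L *: p = qvec d k.
  have : [set zr R L *: p | p in P] (zr R L *: p) by exists p.
  by rewrite PE => -[k k_vs <-]; exists k.
pose lambda := zr R L * zr R million * zr R (inner_norm w) *
  zr R (outer_norm w).
have lambda_gt0 : 0 < lambda.
  by rewrite /lambda millE /inner_norm /outer_norm !zrM !mulr_gt0 ?zr_gt0.
have innerE : lambda *: translation (zr R X / 10 ^+ 6) (zr R Y / 10 ^+ 6)
    (rotation a (projection t1 p1 ((zr R mu / 10 ^+ 6) *: p))) =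
    qvec2 d (inner_image w L mu k).
  set v := rotation _ _.
  have [x [y vE]] : exists x y, v = vec2 x y.
    rewrite /v; case: (projection _ _ _) (projectionE t1 p1
      ((zr R mu / 10 ^+ 6) *: p)) => _ ->.
    by rewrite rotationE; eexists; eexists.
  (* Projection and rotation are linear, so the factor mu comes out in front of both. *)
  have vP : (zr R (inner_norm w) * zr R L * 10 ^+ 6) *: v =
      zr R mu *: qvec2 d (zrot al (zproj th1 ph1 k)).
    rewrite -(zrotP _ _ _ _ _ aP (zprojP _ _ _ _ _ _ _ t1P p1P pk)).
    rewrite /v /rotation /projection -!scalemxAr !scalerA.
    congr (_ *: _); rewrite /inner_norm /= !zrM.
    by field.
  have [{}vP0 {}vP1] : (zr R (inner_norm w) * zr R L * 10 ^+ 6) * x =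
        zr R mu * qr R d (zrot al (zproj th1 ph1 k)).1 /\
      (zr R (inner_norm w) * zr R L * 10 ^+ 6) * y =
        zr R mu * qr R d (zrot al (zproj th1 ph1 k)).2.
    by apply: vec2_inj; rewrite -!scale_vec2 -vE vP.
  rewrite vE translationE scale_vec2 /inner_image qvec2Z /qvec2 /=.
  rewrite scale_vec2 !qrD !qrZ !qr_int !zrM -vP0 -vP1 /lambda millE.
  rewrite /inner_norm /outer_norm !zrM.
  by congr vec2; field.
(* Every listed position is the scaled image of an actual point of [P], so triangle corners do
   belong to the outer projection. *)
have outerE i : (i < size vs)%N -> exists2 r,
    (projection t2 p2 @` P) r &
    lambda *: r = qvec2 d (nth (qint 0%ZZ, qint 0%ZZ)
      [seq outer_image w k | k <- vs] i).
  move=> i_lt; set k0 : quad3 := (qint 0%ZZ, qint 0%ZZ, qint 0%ZZ).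
  have : [set qvec d k | k in [set` vs]] (qvec d (nth k0 vs i) : 'cV[R]_3).
    by exists (nth k0 vs i) => //=; exact: mem_nth.
  rewrite -PE => -[r Pr rk]; exists (projection t2 p2 r); first by exists r.
  rewrite (nth_map k0) // /outer_image qvec2Z.
  rewrite -(zprojP _ _ _ _ _ _ _ t2P p2P rk) scalerA; congr (_ *: _).
  by rewrite /lambda zrM /inner_norm /outer_norm !zrM /=; ring.
have /hasP[_ /mapP[[[i j] l] t_in ->] in_t] := allP covered k k_vs.
have /and3P[/= i_lt j_lt l_lt] := allP ts_lt _ t_in.
have [ri ri_im riE] := outerE _ i_lt; have [rj rj_im rjE] := outerE _ j_lt.
have [rl rl_im rlE] := outerE _ l_lt.
have /and3P[/= ij jl li] := in_t.
apply: (hull_interior_triangle _ ri rj rl) => //.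
- exact: zcross_gt0 d_ge0 lambda_gt0 riE rjE innerE ij.
- exact: zcross_gt0 d_ge0 lambda_gt0 rjE rlE innerE jl.
- exact: zcross_gt0 d_ge0 lambda_gt0 rlE riE innerE li.
Qed.

(** A feasible mu is at most the supremum. The bound is [a] thousandths plus [b] millionths, hence
    1000 a + b in the millionths used by the checker. *)
Lemma nieuwland_ge (R : realType) (P : set 'cV[R]_3) (a b : nat) d L vs w ts :
  [set zr R L *: p | p in P] = [set qvec d k | k in [set` vs]] ->
  check_passage d L (1000 * Z.of_nat a + Z.of_nat b)%ZZ vs w ts ->
  ((a%:R / 10 ^+ 3 + b%:R / 10 ^+ 6)%:E <= nieuwland P)%E.
Proof.
move=> PE chk; apply: ereal_sup_ubound.
exists (a%:R / 10 ^+ 3 + b%:R / 10 ^+ 6) => //=.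
have := check_passageP R P _ _ _ _ _ _ PE chk.
suff -> : zr R (1000 * Z.of_nat a + Z.of_nat b)%ZZ / 10 ^+ 6 =
  a%:R / 10 ^+ 3 + b%:R / 10 ^+ 6 by [].
have -> : 1000%ZZ = (10 * 10 * 10)%ZZ by [].
rewrite zrD !zrM !zr_nat -[zr R 10]/(10%:R : R).
by field.
Qed.

(** * The solids *)

Lemma zr_pos (R : realType) p : zr R (Z.pos p) = (Pos.to_nat p)%:R.
Proof. by []. Qed.

Lemma zr_neg (R : realType) p : zr R (Z.neg p) = - (Pos.to_nat p)%:R.
Proof. by rewrite -[Z.neg p]/(Z.opp (Z.pos p)) zrN. Qed.

Lemma scale_vec3 (R : realType) (l a b c : R) d (k : quad3) :
  l * a = qr R d k.1.1 -> l * b = qr R d k.1.2 -> l * c = qr R d k.2 ->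
  l *: vec3 a b c = qvec d k.
Proof.
move=> ea eb ec; apply/matrixP => i j; rewrite (ord1 j) !mxE.
by case: (ord3P i) => ->.
Qed.

Lemma scaled_setU (R : realType) (l : R) d (A B : set 'cV[R]_3) vs ws :
  [set l *: p | p in A] = [set qvec d k | k in [set` vs]] ->
  [set l *: p | p in B] = [set qvec d k | k in [set` ws]] ->
  [set l *: p | p in A `|` B] = [set qvec d k | k in [set` vs ++ ws]].
Proof.
move=> eA eB; rewrite image_setU eA eB -image_setU; congr (_ @` _).
by apply/seteqP; split=> k /=; rewrite mem_cat => /orP.
Qed.

Lemma sqr_sqrt5 (R : realType) : Num.sqrt 5 ^+ 2 = 5 :> R.
Proof. by rewrite sqr_sqrtr. Qed.

(** Together with [golden_sqr], this makes all vertex coordinates affine in sqrt 5, so that linear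
    arithmetic can compare them with their codes. *)
Lemma goldenV (R : realType) : (golden R)^-1 = (Num.sqrt 5 - 1) / 2.
Proof.
have w_ge0 : 0 <= Num.sqrt 5 :> R by exact: sqrtr_ge0.
have w2 := sqr_sqrt5 R.
have g_neq0 : golden R != 0 by rewrite /golden lt0r_neq0 //; lra.
apply: (mulfI g_neq0); rewrite divff // /golden.
by move: w2; set w := Num.sqrt _; nra.
Qed.

Lemma golden_sqr (R : realType) : golden R ^+ 2 = (3 + Num.sqrt 5) / 2.
Proof. by have := sqr_sqrt5 R; rewrite /golden; set w := Num.sqrt _; nra. Qed.

(** Identifies one scaled orbit of vertices with its coded list; what remains is one linear equation
    in the square root per coordinate. *)
Ltac scaled_vertices :=
  apply: signed_permsE;
  [ first [ exact: enumerates_id | exact: enumerates_even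
          | exact: enumerates_odd | exact: enumerates_any ]
  | first [ exact: enumerates_any_signs | exact: enumerates_even_signs ]
  | apply: scale_vec3; rewrite ?div1r ?goldenV ?golden_sqr /golden /qr /=
      ?zr_pos ?zr_neg ?zr0 /Pos.to_nat /=; lra ].

(** * Certificates for the twelve solids *)

Definition tetrahedron_vertices : seq quad3 :=
  (signed_codes id_codes even_sign_codes ((1, 0), (1, 0), (1, 0)))%ZZ.

(** The pair [(1, 1)] is a right angle, and a pair with entries of opposite signs is an angle
    between pi and 2 pi. *)
Definition tetrahedron_placement :=
  Placement (-151, 48)%ZZ (1, 1)%ZZ (56, 97)%ZZ (99, 41)%ZZ (44, 85)%ZZ
            (-171572, 99057)%ZZ.

Definition tetrahedron_triangles : seq (nat * nat * nat) :=
  [:: (0, 2, 3)]%N.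

Lemma tetrahedron_ge (R : realType) :
  ((1014 / 10 ^+ 3 + 473 / 10 ^+ 6)%:E
    <= nieuwland (tetrahedron R))%E.
Proof.
(* The last two numbers are [d] and [L]. The coordinates are integers here, coded with zero
   coefficients of sqrt 2. *)
apply: (@nieuwland_ge _ _ 1014 473 2 1
  tetrahedron_vertices tetrahedron_placement
  tetrahedron_triangles); last by vm_compute.
scaled_vertices.
Qed.

Definition dodecahedron_vertices : seq quad3 :=
  (signed_codes id_codes any_sign_codes ((2, 0), (2, 0), (2, 0)) ++
    signed_codes even_codes any_sign_codes ((0, 0), (-1, 1), (1, 1)))%ZZ.

(** This solid is centrally symmetric, so both shadows are centred at the origin and the shift is
    zero; only the tetrahedron and the truncated tetrahedron are shifted. *)
Definition dodecahedron_placement :=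
  Placement (311, 203)%ZZ (110, 101)%ZZ (297, 245)%ZZ (136, 117)%ZZ
            (1272, 587)%ZZ (0, 0)%ZZ.

Definition dodecahedron_triangles : seq (nat * nat * nat) :=
  [:: (26, 11, 4); (26, 27, 25); (26, 25, 24); (26, 4, 8); (3, 11, 7);
      (25, 0, 24); (26, 7, 27); (26, 8, 0)]%N.

Lemma dodecahedron_ge (R : realType) :
  ((1010 / 10 ^+ 3 + 818 / 10 ^+ 6)%:E
    <= nieuwland (dodecahedron R))%E.
Proof.
apply: (@nieuwland_ge _ _ 1010 818 5 2
  dodecahedron_vertices dodecahedron_placement
  dodecahedron_triangles); last by vm_compute.
rewrite /dodecahedron_vertices; do ?apply: scaled_setU;
  scaled_vertices.
Qed.

Definition icosahedron_vertices : seq quad3 :=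
  (signed_codes even_codes any_sign_codes ((0, 0), (1, 1), (2, 0)))%ZZ.

Definition icosahedron_placement :=
  Placement (-4, 21)%ZZ (41, 153)%ZZ (17, 14)%ZZ (35, 101)%ZZ (47, 89)%ZZ
            (0, 0)%ZZ.

Definition icosahedron_triangles : seq (nat * nat * nat) :=
  [:: (9, 18, 2); (1, 10, 17); (9, 1, 17); (9, 18, 1); (9, 17, 2)]%N.

Lemma icosahedron_ge (R : realType) :
  ((1010 / 10 ^+ 3 + 805 / 10 ^+ 6)%:E
    <= nieuwland (icosahedron R))%E.
Proof.
apply: (@nieuwland_ge _ _ 1010 805 5 2
  icosahedron_vertices icosahedron_placement
  icosahedron_triangles); last by vm_compute.
scaled_vertices.
Qed.

Definition truncated_tetrahedron_vertices : seq quad3 :=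
  (signed_codes any_codes even_sign_codes ((1, 0), (1, 0), (3, 0)))%ZZ.

Definition truncated_tetrahedron_placement :=
  Placement (0, 1)%ZZ (70, 169)%ZZ (-46, 49)%ZZ (-81, 143)%ZZ (99, 119)%ZZ
            (151517, -162790)%ZZ.

Definition truncated_tetrahedron_triangles : seq (nat * nat * nat) :=
  [:: (9, 1, 8); (10, 9, 3); (10, 8, 0)]%N.

Lemma truncated_tetrahedron_ge (R : realType) :
  ((1014 / 10 ^+ 3 + 210 / 10 ^+ 6)%:E
    <= nieuwland (truncated_tetrahedron R))%E.
Proof.
apply: (@nieuwland_ge _ _ 1014 210 2 1
  truncated_tetrahedron_vertices truncated_tetrahedron_placement
  truncated_tetrahedron_triangles); last by vm_compute.
scaled_vertices.
Qed.

Definition truncated_cube_vertices : seq quad3 :=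
  (signed_codes any_codes any_sign_codes ((1, 0), (1, 0), (-1, 1)))%ZZ.

(** Here [phi1] is pi: the inner view is along a coordinate axis, and the hull of the inner shadow
    is a square. *)
Definition truncated_cube_placement :=
  Placement (379, 89)%ZZ (1, 0)%ZZ (-875, 46)%ZZ (127, 218)%ZZ
            (281, 128)%ZZ (0, 0)%ZZ.

Definition truncated_cube_triangles : seq (nat * nat * nat) :=
  [:: (3, 22, 15); (3, 14, 8); (4, 17, 8); (23, 15, 4); (3, 16, 8)]%N.

Lemma truncated_cube_ge (R : realType) :
  ((1030 / 10 ^+ 3 + 659 / 10 ^+ 6)%:E
    <= nieuwland (truncated_cube R))%E.
Proof.
apply: (@nieuwland_ge _ _ 1030 659 2 1
  truncated_cube_vertices truncated_cube_placement
  truncated_cube_triangles); last by vm_compute.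
scaled_vertices.
Qed.

Definition truncated_octahedron_vertices : seq quad3 :=
  (signed_codes any_codes any_sign_codes ((0, 0), (1, 0), (2, 0)))%ZZ.

(** 70/169 approximates tan(pi/8) = sqrt 2 - 1 and 56/97 approximates tan(pi/6), so [theta1] is
    close to pi/4 and [phi2] to pi/3. *)
Definition truncated_octahedron_placement :=
  Placement (70, 169)%ZZ (1, 1)%ZZ (-140, 99)%ZZ (75, 236)%ZZ (56, 97)%ZZ
            (0, 0)%ZZ.

Definition truncated_octahedron_triangles : seq (nat * nat * nat) :=
  [:: (9, 1, 17); (9, 34, 41); (9, 42, 25); (26, 10, 33); (10, 17, 42);
      (9, 18, 41)]%N.

Lemma truncated_octahedron_ge (R : realType) :
  ((1014 / 10 ^+ 3 + 602 / 10 ^+ 6)%:E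
    <= nieuwland (truncated_octahedron R))%E.
Proof.
apply: (@nieuwland_ge _ _ 1014 602 2 1
  truncated_octahedron_vertices truncated_octahedron_placement
  truncated_octahedron_triangles); last by vm_compute.
scaled_vertices.
Qed.

Definition rhombicuboctahedron_vertices : seq quad3 :=
  (signed_codes any_codes any_sign_codes ((1, 0), (1, 0), (1, 1)))%ZZ.

(** Here [theta1] is 3 pi/2 and [phi1] is pi/2: the inner view is along the second coordinate axis,
    where the shadow is a regular octagon. *)
Definition rhombicuboctahedron_placement :=
  Placement (-1, 1)%ZZ (1, 1)%ZZ (229, 20)%ZZ (153, 271)%ZZ (190, 577)%ZZ
            (0, 0)%ZZ.

Definition rhombicuboctahedron_triangles : seq (nat * nat * nat) :=
  [:: (22, 14, 19); (12, 21, 9); (22, 9, 20); (22, 18, 1); (22, 12, 14);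
      (22, 19, 17); (22, 11, 9)]%N.

Lemma rhombicuboctahedron_ge (R : realType) :
  ((1012 / 10 ^+ 3 + 819 / 10 ^+ 6)%:E
    <= nieuwland (rhombicuboctahedron R))%E.
Proof.
apply: (@nieuwland_ge _ _ 1012 819 2 1
  rhombicuboctahedron_vertices rhombicuboctahedron_placement
  rhombicuboctahedron_triangles); last by vm_compute.
scaled_vertices.
Qed.

Definition truncated_cuboctahedron_vertices : seq quad3 :=
  (signed_codes any_codes any_sign_codes ((1, 0), (1, 1), (1, 2)))%ZZ.

Definition truncated_cuboctahedron_placement :=
  Placement (37, 44)%ZZ (0, 1)%ZZ (73, 87)%ZZ (-69, 13)%ZZ (19, 17)%ZZ
            (0, 0)%ZZ.

Definition truncated_cuboctahedron_triangles : seq (nat * nat * nat) :=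
  [:: (14, 45, 25); (30, 9, 42); (5, 1, 3); (2, 6, 4); (14, 13, 28);
      (45, 3, 27); (42, 4, 28)]%N.

Lemma truncated_cuboctahedron_ge (R : realType) :
  ((1006 / 10 ^+ 3 + 563 / 10 ^+ 6)%:E
    <= nieuwland (truncated_cuboctahedron R))%E.
Proof.
apply: (@nieuwland_ge _ _ 1006 563 2 1
  truncated_cuboctahedron_vertices truncated_cuboctahedron_placement
  truncated_cuboctahedron_triangles); last by vm_compute.
scaled_vertices.
Qed.

(** The scale is 4 because of the halved coordinates. The first 48 entries repeat the six vertices
    on the axes. *)
Definition icosidodecahedron_vertices : seq quad3 :=
  (signed_codes any_codes any_sign_codes ((0, 0), (0, 0), (2, 2)) ++
    signed_codes even_codes any_sign_codes ((2, 0), (1, 1), (3, 1)))%ZZ.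

Definition icosidodecahedron_placement :=
  Placement (-66, 215)%ZZ (111, 145)%ZZ (-221, 35)%ZZ (0, 1)%ZZ
            (25, 88)%ZZ (0, 0)%ZZ.

Definition icosidodecahedron_triangles : seq (nat * nat * nat) :=
  [:: (9, 66, 58); (61, 58, 69); (9, 61, 66); (60, 8, 58); (9, 70, 66);
      (9, 66, 59); (60, 65, 69); (9, 8, 65)]%N.

Lemma icosidodecahedron_ge (R : realType) :
  ((1000 / 10 ^+ 3 + 878 / 10 ^+ 6)%:E
    <= nieuwland (icosidodecahedron R))%E.
Proof.
apply: (@nieuwland_ge _ _ 1000 878 5 4
  icosidodecahedron_vertices icosidodecahedron_placement
  icosidodecahedron_triangles); last by vm_compute.
rewrite /icosidodecahedron_vertices; do ?apply: scaled_setU;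
  scaled_vertices.
Qed.

Definition truncated_dodecahedron_vertices : seq quad3 :=
  ((signed_codes even_codes any_sign_codes ((0, 0), (-1, 1), (5, 1)) ++
    signed_codes even_codes any_sign_codes ((-1, 1), (1, 1), (2, 2))) ++
    signed_codes even_codes any_sign_codes ((1, 1), (4, 0), (3, 1)))%ZZ.

Definition truncated_dodecahedron_placement :=
  Placement (255, 178)%ZZ (252, 247)%ZZ (29, 61)%ZZ (-24, 409)%ZZ
            (185, 44)%ZZ (0, 0)%ZZ.

Definition truncated_dodecahedron_triangles : seq (nat * nat * nat) :=
  [:: (11, 62, 32); (71, 40, 33); (39, 43, 64); (63, 43, 62);
      (40, 44, 57); (11, 39, 33); (63, 47, 43); (71, 56, 40);
      (62, 38, 8); (11, 57, 33); (47, 8, 32); (11, 39, 63); (11, 32, 56)]%N.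

Lemma truncated_dodecahedron_ge (R : realType) :
  ((1001 / 10 ^+ 3 + 612 / 10 ^+ 6)%:E
    <= nieuwland (truncated_dodecahedron R))%E.
Proof.
apply: (@nieuwland_ge _ _ 1001 612 5 2
  truncated_dodecahedron_vertices truncated_dodecahedron_placement
  truncated_dodecahedron_triangles); last by vm_compute.
rewrite /truncated_dodecahedron_vertices; do ?apply: scaled_setU;
  scaled_vertices.
Qed.

Definition truncated_icosahedron_vertices : seq quad3 :=
  ((signed_codes odd_codes any_sign_codes ((0, 0), (2, 0), (3, 3)) ++
    signed_codes odd_codes any_sign_codes ((2, 0), (5, 1), (2, 2))) ++
    signed_codes odd_codes any_sign_codes ((1, 1), (4, 0), (4, 2)))%ZZ.

Definition truncated_icosahedron_placement :=
  Placement (31, 191)%ZZ (44, 85)%ZZ (139, 207)%ZZ (-1, 1)%ZZ (14, 115)%ZZ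
            (0, 0)%ZZ.

Definition truncated_icosahedron_triangles : seq (nat * nat * nat) :=
  [:: (11, 51, 48); (62, 56, 9); (63, 0, 33); (39, 3, 57); (11, 63, 39);
      (11, 32, 0); (3, 38, 62); (8, 56, 32); (33, 57, 9); (11, 62, 10);
      (11, 55, 32); (11, 3, 51)]%N.

Lemma truncated_icosahedron_ge (R : realType) :
  ((1001 / 10 ^+ 3 + 955 / 10 ^+ 6)%:E
    <= nieuwland (truncated_icosahedron R))%E.
Proof.
apply: (@nieuwland_ge _ _ 1001 955 5 2
  truncated_icosahedron_vertices truncated_icosahedron_placement
  truncated_icosahedron_triangles); last by vm_compute.
rewrite /truncated_icosahedron_vertices; do ?apply: scaled_setU;
  scaled_vertices.
Qed.

Definition truncated_icosidodecahedron_vertices : seq quad3 :=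
  ((((signed_codes even_codes any_sign_codes ((-1, 1), (-1, 1), (7, 1)) ++
    signed_codes even_codes any_sign_codes ((-2, 2), (1, 1), (4, 2))) ++
    signed_codes even_codes any_sign_codes ((-1, 1), (3, 1), (1, 3))) ++
    signed_codes even_codes any_sign_codes ((0, 2), (4, 0), (5, 1))) ++
    signed_codes even_codes any_sign_codes ((1, 1), (6, 0), (2, 2)))%ZZ.

Definition truncated_icosidodecahedron_placement :=
  Placement (-19, 103)%ZZ (56, 97)%ZZ (-108, 215)%ZZ (113, 38)%ZZ
            (161, 429)%ZZ (0, 0)%ZZ.

Definition truncated_icosidodecahedron_triangles : seq (nat * nat * nat) :=
  [:: (101, 63, 116); (36, 95, 64); (12, 86, 95); (71, 11, 81);
      (60, 81, 88); (60, 36, 68); (60, 67, 47); (86, 101, 115);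
      (115, 111, 68); (81, 98, 116); (60, 36, 12); (60, 47, 95);
      (60, 59, 35); (60, 35, 11); (60, 40, 88)]%N.

Lemma truncated_icosidodecahedron_ge (R : realType) :
  ((1002 / 10 ^+ 3 + 48 / 10 ^+ 6)%:E
    <= nieuwland (truncated_icosidodecahedron R))%E.
Proof.
apply: (@nieuwland_ge _ _ 1002 48 5 2
  truncated_icosidodecahedron_vertices truncated_icosidodecahedron_placement
  truncated_icosidodecahedron_triangles); last by vm_compute.
rewrite /truncated_icosidodecahedron_vertices; do ?apply: scaled_setU;
  scaled_vertices.
Qed.

Theorem mainTheorem6 (R : realType) :
  ((1014 / 10 ^+ 3 + 473 / 10 ^+ 6)%:E <= nieuwland (tetrahedron R))%E /\
  ((1010 / 10 ^+ 3 + 818 / 10 ^+ 6)%:E <= nieuwland (dodecahedron R))%E /\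
  ((1010 / 10 ^+ 3 + 805 / 10 ^+ 6)%:E <= nieuwland (icosahedron R))%E /\
  ((1014 / 10 ^+ 3 + 210 / 10 ^+ 6)%:E <= nieuwland (truncated_tetrahedron R))%E /\
  ((1030 / 10 ^+ 3 + 659 / 10 ^+ 6)%:E <= nieuwland (truncated_cube R))%E /\
  ((1014 / 10 ^+ 3 + 602 / 10 ^+ 6)%:E <= nieuwland (truncated_octahedron R))%E /\
  ((1012 / 10 ^+ 3 + 819 / 10 ^+ 6)%:E <= nieuwland (rhombicuboctahedron R))%E /\
  ((1006 / 10 ^+ 3 + 563 / 10 ^+ 6)%:E <= nieuwland (truncated_cuboctahedron R))%E /\
  ((1000 / 10 ^+ 3 + 878 / 10 ^+ 6)%:E <= nieuwland (icosidodecahedron R))%E /\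
  ((1001 / 10 ^+ 3 + 612 / 10 ^+ 6)%:E <= nieuwland (truncated_dodecahedron R))%E /\
  ((1001 / 10 ^+ 3 + 955 / 10 ^+ 6)%:E <= nieuwland (truncated_icosahedron R))%E /\
  ((1002 / 10 ^+ 3 + 48 / 10 ^+ 6)%:E
     <= nieuwland (truncated_icosidodecahedron R))%E.
Proof.
split; first exact: tetrahedron_ge.
split; first exact: dodecahedron_ge.
split; first exact: icosahedron_ge.
split; first exact: truncated_tetrahedron_ge.
split; first exact: truncated_cube_ge.
split; first exact: truncated_octahedron_ge.
split; first exact: rhombicuboctahedron_ge.
split; first exact: truncated_cuboctahedron_ge.
split; first exact: icosidodecahedron_ge.
split; first exact: truncated_dodecahedron_ge.
split; first exact: truncated_icosahedron_ge.
exact: truncated_icosidodecahedron_ge.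
Qed.
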